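(* Let $\mathcal D$ be a data cube, let $D_i$ be one of its dimensions and let $a\in dom(D_i)$. Then the operation $\mathsf{SLICE\text{-}DICE}(\mathcal D,D_i,a)$ is expressible as an OLAP operation.
   Context: **Dimensions.** A dimension $D$ has a schema $\sigma(D)$: a finite lattice, viewed as a directed graph of levels, with a unique top node $All$ (only incoming edges) and a unique bottom node $Bottom$ (only outgoing edges), all maximal-length paths going from $Bottom$ to $All$. A path from $Bottom$ to $All$ is a hierarchy of $\sigma(D)$. Each level $\ell$ has a non-empty finite set $dom(D.\ell)$, with $dom(D.All)=\{all\}$ and $dom(D.Bottom)=dom(D)$, and $dom(D)$ is totally ordered by $<$. A dimension graph $I(\sigma(D))$ is a directed acyclic graph with node set $\bigcup_\ell dom(D.\ell)$, in which an edge from $a\in dom(D.\ell)$ to $a'\in dom(D.\ell')$ can exist only if $\ell\to\ell'$ is an edge of $\sigma(D)$. For each hierarchy $H$, the subgraph $I_H(\sigma(D))$ on the nodes belonging to the levels of $H$ is a directed tree, directed towards its root $all$. Write $\rho_H(a,b)$ (''$a$ rolls up to $b$'') if $b$ is reachable from $a$ in $I_H(\sigma(D))$ (with $a$ rolling up to itself), and $\rho$ if $H$ is clear from the context. Dimension graphs are sound: for every level $\ell$, hierarchies $H_1,H_2$ reaching $\ell$ from $Bottom$, $a\in dom(D)$ and $b_1,b_2\in dom(D.\ell)$, $\rho_{H_1}(a,b_1)$ and $\rho_{H_2}(a,b_2)$ imply $b_1=b_2$. Every $b\in dom(D.\ell)$ has at least one $a\in dom(D)$ with $\rho(a,b)$;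 $rep(b)$ denotes the smallest such $a$. Put $b_1<b_2$ in $dom(D.\ell)$ iff $rep(b_1)<rep(b_2)$. **Data cubes.** A $d$-dimensional data cube $\mathcal D$ ($d\ge1$) consists of: the matrix $M(\mathcal D)=dom(D_1)\times\cdots\times dom(D_d)$, whose elements are called cells; sound dimension graphs $I(\sigma(D_i))$; protected measures $\mu_1,\dots,\mu_k$ and computed measures $\tau_1,\dots,\tau_l$ ($l\ge0$), which are functions from the cells to $\mathbb Q$; and a flag $\varphi$ from the cells to $\{0,1\}$. Some cells may be empty (destroyed): they carry no measures and no flag, they are ignored in all computations, and no measure is ever added to them. **Prime labels.** These are the numbers $1,\sqrt2,\sqrt3,\sqrt5,\sqrt7,\dots,\sqrt{p_n},\dots$ ($p_n$ the $n$-th prime), used symbolically; intermediate computed measures may have values involving them. A prime product label is a product of prime labels coming from labelings of different dimensions that use disjoint sets of labels. If the label of a cell is the product of labels for the dimensions with index in $I\subseteq\{1,\dots,d\}$, then for a rational-valued measure $\mu$ the sum over all non-empty cells of $\mu$ times the label is called a (full or partial) prime sum; it can be written $\sum_w a_w w$, with $w$ ranging over the labels that occur. **Atomic OLAP transformations.** Each creates, in all non-empty cells $(x_1,\dots,x_d)$, a new measure $\tau_{new}$ from the existing measures; $\alpha,\beta$ denote existing (protected or computed) measures. - Arithmetic: $\tau_{new}=c$ with $c\in\mathbb Q$; $\tau_{new}=\alpha+\beta$; $\tau_{new}=\alpha\cdot\beta$; $\tau_{new}=\alpha/\beta$, with the convention $a/0:=a$. - Boolean (values $0/1$, cell per cell):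 $(\alpha=\beta)$; $(\alpha<\beta)$; $(\ell=c)$ for a level $\ell$ of $\sigma(D_i)$ and $c\in dom(D_i.\ell)$, equal to $1$ iff $\rho(x_i,c)$; $(\ell<_\ell c)$, equal to $1$ iff $x_i$ rolls up to some $b\in dom(D_i.\ell)$ with $b<_\ell c$, where $<_\ell$ is any order defined on level $\ell$; similarly $(c<_\ell \ell)$. - Selectors: the constant selector $\sigma_{D_i.\ell=c}$, which equals the test $(\ell=c)$; the level selector $\sigma_{D_i.\ell}$, equal to $1$ iff $x_i=rep(b)$ for some $b\in dom(D_i.\ell)$, and $0$ otherwise. - Global aggregates (the same value in all non-empty cells): $\#_{\neq}(\alpha)$, the number of distinct values of $\alpha$ in the matrix; $\mathrm{SUM}_d(\alpha)$, the sum of $\alpha$ over all non-empty cells; $\min(\alpha)$; $\max(\alpha)$. - Grouped aggregates: if $\tau_m$ is a prime (product) labeling of the cells, then $\#_{\neq}|_{\tau_m}(\alpha)$, $\min|_{\tau_m}(\alpha)$ and $\max|_{\tau_m}(\alpha)$ are, in each cell $x$, the number of distinct values, minimum and maximum of $\alpha$ over the cells having the same label as $\tau_m(x)$. - Grouping: $\gamma_{D_i.\ell}$, where $dom(D_i.\ell)=\{b_1<\dots<b_s\}$: the next $s$ prime labels not yet used by earlier transformations are assigned in order to $b_1,\dots,b_s$, and a cell with $\rho(x_i,b_j)$ receives the label of $b_j$. Projection of a prime sum $\tau_m|_{\tau_n}$: if $\tau_m$ is a prime sum $\sum_w a_w w$ over the labels of an earlier prime (product) labeling $\tau_n$, the new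 measure has value $a_w$ in each cell where $\tau_n=w$. **OLAP operation (of arity $m$).** It is a finite sequence of $n$ atomic transformations creating $\tau_{l+1},\dots,\tau_{l+n}$, followed by the creation of a Boolean measure $\varphi^{(m)}$ (the output flag), optionally preceded by the creation of a Boolean measure $\delta$ (a destructor); $\delta$ and $\varphi^{(m)}$ are created by atomic transformations or set equal to existing Boolean measures. In the output cube, dimensions, schemas and dimension graphs are unchanged; cells with $\delta=0$ are emptied (even of their protected measures); in the other non-empty cells the measures are $\mu_1,\dots,\mu_k$, the last $m$ computed measures $\tau_{l+n-m+1},\dots,\tau_{l+n}$ (renamed $\tau_1,\dots,\tau_m$), and the new flag $\varphi^{(m)}$ replacing the old one. An operation on data cubes is expressible as an OLAP operation if there is an OLAP operation (its sequence of transformations being chosen from the parameters of the operation, the numbers of measures, and the dimension schemas and graphs) whose output on the input cube is the output of the operation. **Slice-and-Dice.** The output of $\mathsf{SLICE\text{-}DICE}(\mathcal D,D_i,a)$ contains all the (non-empty) cells $(x_1,\dots,x_d)$ of $M(\mathcal D)$ with $x_i=a$, with their measures and with flag $1$; all other cells are destroyed. *)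

(* Defs.v *)
From HB Require Import structures.
From mathcomp Require Import all_boot all_order all_algebra.
From mathcomp Require Import realalg.
From mathcomp Require Import boolp.

Set Implicit Arguments.
Unset Strict Implicit.
Unset Printing Implicit Defensive.

Import Order.TTheory GRing.Theory Num.Theory.

Local Open Scope ring_scope.

(** * Dimensions *)

(* A finite lattice seen as a directed graph: reachability is the lattice
   order, which makes the graph acyclic and makes all its maximal paths go from
   [\bot] to [\top].  The edges may be the covering pairs of the lattice, but
   additional edges of the order are not excluded. *)
Record schema := Schema {
  level_disp : Order.disp_t;
  level :> finTBLatticeType level_disp;
  level_edge : rel level;
  level_edge_irr : irreflexive level_edge;
  level_edge_connect : forall x y, connect level_edge x y = (x <= y)%O
}.

Definition All (S : schema) : S := Order.top.
Definition Bottom (S : schema) : S := Order.bottom.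

(* A hierarchy is the sequence of levels of a path from Bottom to All. *)
Definition hierarchy (S : schema) (H : seq S) : bool :=
  if H is x :: p then
    [&& x == Bottom S, path (@level_edge S) x p & last x p == All S]
  else false.

(* The domains of different levels are subsets of one finite type; they are
   not assumed to be disjoint. *)
Record predimension := Predimension {
  sch : schema;
  elem : finType;
  dom : sch -> {set elem};
  base_lt : rel elem;
  graph : rel elem
}.

Section Predimension.

Variable D : predimension.

Definition base : {set elem D} := dom (Bottom (sch D)).

Definition hnodes (H : seq (sch D)) : {set elem D} :=
  [set a | has (fun l => a \in dom l) H].

Definition hgraph (H : seq (sch D)) : rel (elem D) :=
  [rel a b | [&& a \in hnodes H, b \in hnodes H & graph a b]].

Definition rollup (H : seq (sch D)) (a b : elem D) : bool :=
  [&& a \in hnodes H, b \in hnodes H & connect (hgraph H) a b].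

(* [rolls_up l a b] is rho(a, b) for an element b of level l, along some
   hierarchy through l. *)
Definition rolls_up (l : sch D) (a b : elem D) : Prop :=
  b \in dom l /\ exists H, [/\ hierarchy H, l \in H & rollup H a b].

(* In-tree on the nodes of H: from every node there is exactly one directed
   path to the root. *)
Definition in_tree (H : seq (sch D)) (r : elem D) : Prop :=
  r \in hnodes H /\
  forall a, a \in hnodes H ->
    exists! p : seq (elem D), path (hgraph H) a p /\ last a p = r.

Definition sound : Prop :=
  forall (l : sch D) (H1 H2 : seq (sch D)) (a b1 b2 : elem D),
    hierarchy H1 -> hierarchy H2 -> l \in H1 -> l \in H2 ->
    a \in base -> b1 \in dom l -> b2 \in dom l ->
    rollup H1 a b1 -> rollup H2 a b2 -> b1 = b2.

(* [is_rep l b a] is a = rep(b), for b in level l. *)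
Definition is_rep (l : sch D) (b a : elem D) : Prop :=
  [/\ a \in base, rolls_up l a b &
      forall a', a' \in base -> rolls_up l a' b -> a' = a \/ base_lt a a'].

Definition level_lt (l : sch D) (b1 b2 : elem D) : Prop :=
  exists a1 a2, [/\ is_rep l b1 a1, is_rep l b2 a2 & base_lt a1 a2].

Definition strict_order_on (A : {set elem D}) (r : rel (elem D)) : Prop :=
  {in A, forall x, ~~ r x x} /\ {in A & A & A, forall y x z, r x y -> r y z -> r x z}.

Definition total_on (A : {set elem D}) (r : rel (elem D)) : Prop :=
  {in A &, forall x y, x != y -> r x y || r y x}.

End Predimension.

Record dimension := Dimension {
  predim :> predimension;
  dom_neq0 : forall l : sch predim, dom l != set0;
  all_elt : elem predim;
  dom_All : dom (All (sch predim)) = [set all_elt];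
  base_lt_order : strict_order_on (base predim) (@base_lt predim);
  base_lt_total : total_on (base predim) (@base_lt predim);
  graph_edge : forall a a', @graph predim a a' ->
    exists l l' : sch predim, [/\ level_edge l l', a \in dom l & a' \in dom l'];
  graph_acyclic : forall a p, ~~ cycle (@graph predim) (a :: p);
  graph_tree : forall H, hierarchy H -> in_tree H all_elt;
  graph_sound : sound predim;
  graph_covered : forall (l : sch predim) b, b \in dom l ->
    exists2 a, a \in base predim & rolls_up l a b
}.

(** * Data cubes *)

Definition member (D : dimension) := {a : elem D | a \in base D}.

Definition cell (d : nat) (D : 'I_d -> dimension) :=
  {dffun forall i : 'I_d, member (D i)}.

Definition coord (d : nat) (D : 'I_d -> dimension) (x : cell D) (i : 'I_d) :
  elem (D i) := val (x i).

Record cell_data (k l : nat) := CellData {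
  protected : k.-tuple rat;
  computed : l.-tuple rat;
  flag : bool
}.

(* [None] is an empty (destroyed) cell. *)
Definition cube (d : nat) (D : 'I_d -> dimension) (k l : nat) :=
  cell D -> option (cell_data k l).

Definition nonempty (d : nat) (D : 'I_d -> dimension) (k l : nat)
  (C : cube D k l) : {set cell D} := [set x | isSome (C x)].

(** * Prime labels *)

Lemma ex_next_prime (n : nat) : exists p, (n < p)%N && prime p.
Proof. by have [p np pp] := prime_above n; exists p; rewrite np. Qed.

Definition next_prime (n : nat) : nat := ex_minn (ex_next_prime n).

(* 2, 3, 5, 7, ... *)
Definition nth_prime (n : nat) : nat := iter n next_prime 2%N.

(* Measure values live in the field of real algebraic numbers.  The square
   roots of distinct square-free integers being linearly independent over the
   rationals, labels and prime sums are determined by their values. *)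
Definition value := realalg.

(* 1, sqrt 2, sqrt 3, sqrt 5, ... *)
Definition prime_label (n : nat) : value :=
  if n is n'.+1 then Num.sqrt (nth_prime n')%:R else 1.

(** * Atomic transformations *)

(* Existing measures are designated by their position in the list
   mu_1, ..., mu_k, tau_1, ..., tau_l, tau_(l+1), ... *)
Inductive atomic (d : nat) (D : 'I_d -> dimension) : Type :=
| Const of rat
| Add of nat & nat
| Mul of nat & nat
| Div of nat & nat
| TestEq of nat & nat
| TestLt of nat & nat
| TestLevelEq (i : 'I_d) (l : sch (D i)) (c : elem (D i))
| TestLevelLt (i : 'I_d) (l : sch (D i)) (lt : rel (elem (D i))) (c : elem (D i))
| TestLevelGt (i : 'I_d) (l : sch (D i)) (lt : rel (elem (D i))) (c : elem (D i))
| ConstSelector (i : 'I_d) (l : sch (D i)) (c : elem (D i))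
| LevelSelector (i : 'I_d) (l : sch (D i))
| CountDistinct of nat
| Sum of nat
| Min of nat
| Max of nat
| GroupCountDistinct (label alpha : nat)
| GroupMin (label alpha : nat)
| GroupMax (label alpha : nat)
| Group (i : 'I_d) (l : sch (D i))
| Project (sum label : nat).

Section Semantics.

Variables (d : nat) (D : 'I_d -> dimension).

(* The values of a measure on empty cells are irrelevant: they are never
   read. *)
Definition measure := cell D -> value.

Definition grouping := {i : 'I_d & sch (D i)}.

(* The measures present at some stage, in order of creation, each with the
   grouping that created it, if any. *)
Definition state := seq (measure * option grouping).

Definition getm (st : state) (n : nat) : measure :=
  (nth (fun=> 0, None) st n).1.

Definition getg (st : state) (n : nat) : option grouping :=
  (nth (fun=> 0, None) st n).2.

Definition used_labels (st : state) : nat :=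
  \sum_(e <- st) (if e.2 is Some (existT i l) then #|dom l| else 0).

Definition level_rank (i : 'I_d) (l : sch (D i)) (b : elem (D i)) : nat :=
  #|[set b' in dom l | `[< level_lt l b' b >]]|.

(* tau is the product, over a nonempty set I of dimensions, of labelings
   created by groupings of these dimensions; different groupings always use
   disjoint sets of labels. *)
Definition prime_labeling (ne : {set cell D}) (st : state) (tau : measure) : Prop :=
  exists (I : {set 'I_d}) (g : 'I_d -> nat),
    [/\ I != set0,
        forall i, i \in I -> (g i < size st)%N /\ omap tag (getg st (g i)) = Some i &
        forall x, x \in ne -> tau x = \prod_(i in I) getm st (g i) x].

Definition same_label (ne : {set cell D}) (tau : measure) (x : cell D) :
  {set cell D} := [set y in ne | tau y == tau x].

Definition count_distinct (A : {set cell D}) (alpha : measure) : nat :=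
  size (undup [seq alpha y | y <- enum A]).

(* Used only for A containing x. *)
Definition min_over (A : {set cell D}) (alpha : measure) (x : cell D) : value :=
  \big[Order.min/alpha x]_(y in A) alpha y.

Definition max_over (A : {set cell D}) (alpha : measure) (x : cell D) : value :=
  \big[Order.max/alpha x]_(y in A) alpha y.

Definition test (P : Prop) : value := (`[< P >])%:R.

(* [creates ne st t new]: t is applicable to the measures st of a cube whose
   set of nonempty cells is ne, and creates the measure new. *)
Definition creates (ne : {set cell D}) (st : state) (t : atomic D) (new : measure)
  : Prop :=
  let ok n := (n < size st)%N in
  let m n := getm st n in
  match t with
  | Const c => forall x, x \in ne -> new x = ratr c
  | Add a b => [/\ ok a, ok b & forall x, x \in ne -> new x = m a x + m b x]
  | Mul a b => [/\ ok a, ok b & forall x, x \in ne -> new x = m a x * m b x]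
  | Div a b => [/\ ok a, ok b & forall x, x \in ne ->
      new x = if m b x == 0 then m a x else m a x / m b x]
  | TestEq a b => [/\ ok a, ok b & forall x, x \in ne ->
      new x = test (m a x = m b x)]
  | TestLt a b => [/\ ok a, ok b & forall x, x \in ne ->
      new x = test (m a x < m b x)]
  | TestLevelEq i l c => c \in dom l /\ forall x, x \in ne ->
      new x = test (rolls_up l (coord x i) c)
  | TestLevelLt i l lt c => [/\ c \in dom l, strict_order_on (dom l) lt &
      forall x, x \in ne ->
        new x = test (exists2 b, rolls_up l (coord x i) b & lt b c)]
  | TestLevelGt i l lt c => [/\ c \in dom l, strict_order_on (dom l) lt &
      forall x, x \in ne ->
        new x = test (exists2 b, rolls_up l (coord x i) b & lt c b)]
  | ConstSelector i l c => c \in dom l /\ forall x, x \in ne ->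
      new x = test (rolls_up l (coord x i) c)
  | LevelSelector i l => forall x, x \in ne ->
      new x = test (exists2 b, b \in dom l & is_rep l b (coord x i))
  | CountDistinct a => ok a /\ forall x, x \in ne ->
      new x = (count_distinct ne (m a))%:R
  | Sum a => ok a /\ forall x, x \in ne -> new x = \sum_(y in ne) m a y
  | Min a => ok a /\ forall x, x \in ne -> new x = min_over ne (m a) x
  | Max a => ok a /\ forall x, x \in ne -> new x = max_over ne (m a) x
  | GroupCountDistinct tau a =>
      [/\ ok tau, ok a, prime_labeling ne st (m tau) & forall x, x \in ne ->
        new x = (count_distinct (same_label ne (m tau) x) (m a))%:R]
  | GroupMin tau a =>
      [/\ ok tau, ok a, prime_labeling ne st (m tau) & forall x, x \in ne ->
        new x = min_over (same_label ne (m tau) x) (m a) x]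
  | GroupMax tau a =>
      [/\ ok tau, ok a, prime_labeling ne st (m tau) & forall x, x \in ne ->
        new x = max_over (same_label ne (m tau) x) (m a) x]
  | Group i l => forall x, x \in ne ->
      exists2 b, rolls_up l (coord x i) b &
        new x = prime_label (used_labels st + level_rank l b)
  | Project s tau =>
      [/\ ok s, ok tau, prime_labeling ne st (m tau) &
        exists a : value -> rat, forall x, x \in ne ->
          m s x = \sum_(w <- undup [seq m tau y | y <- enum ne]) ratr (a w) * w /\
          new x = ratr (a (m tau x))]
  end.

Definition grouping_of (t : atomic D) : option grouping :=
  if t is Group i l then Some (existT _ i l) else None.

Inductive runs (ne : {set cell D}) : state -> seq (atomic D) -> state -> Prop :=
| RunsNil st : runs ne st [::] st
| RunsCons st t ts new st' :
    creates ne st t new ->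
    runs ne (rcons st (new, grouping_of t)) ts st' ->
    runs ne st (t :: ts) st'.

(** * OLAP operations *)

(* How a Boolean measure (a destructor or an output flag) is obtained: by an
   atomic transformation, or as an existing Boolean measure, the flag of the
   input cube being one of these. *)
Inductive source : Type :=
| Created of atomic D
| Existing of nat
| InputFlag.

Definition bool_measure (b : cell D -> bool) : measure := fun x => (b x)%:R.

Definition source_grouping (s : source) : option grouping :=
  if s is Created t then grouping_of t else None.

Section Cube.

Variables (k l : nat) (C : cube D k l).

Definition input_flag (x : cell D) : bool :=
  if C x is Some c then flag c else false.

Definition creates_bool (st : state) (s : source) (b : cell D -> bool) : Prop :=
  match s with
  | Created t => creates (nonempty C) st t (bool_measure b)
  | Existing n => (n < size st)%N /\
      forall x, x \in nonempty C -> getm st n x = (b x)%:R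
  | InputFlag => forall x, x \in nonempty C -> b x = input_flag x
  end.

Definition input_measure (j : 'I_k + 'I_l) : measure := fun x =>
  if C x is Some c then
    ratr (match j with inl j => tnth (protected c) j | inr j => tnth (computed c) j end)
  else 0.

Definition init_state : state :=
  [seq (input_measure (inl j), None) | j <- enum 'I_k] ++
  [seq (input_measure (inr j), None) | j <- enum 'I_l].

End Cube.

Record olap_op := OlapOp {
  transformations : seq (atomic D);
  destructor : option source;
  flag_source : source
}.

(* [olap_output op C C']: the operation op of arity m runs on C and outputs C'.
   The destructor, if any, is created after the transformations and before the
   output flag; all are evaluated on the nonempty cells of C, and cells are
   destroyed only in the output. *)
Definition olap_output (k l m : nat) (op : olap_op) (C : cube D k l)
    (C' : cube D k m) : Prop :=
  (m <= l + size (transformations op))%N /\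
  exists (st st' : state) (keep phi : cell D -> bool),
    [/\ runs (nonempty C) (init_state C) (transformations op) st,
        match destructor op with
        | Some s => creates_bool C st s keep /\
                    st' = rcons st (bool_measure keep, source_grouping s)
        | None => (forall x, keep x) /\ st' = st
        end,
        creates_bool C st' (flag_source op) phi &
        forall x : cell D,
          match C x with
          | Some c =>
              if keep x then
                exists2 c', C' x = Some c' &
                  [/\ protected c' = protected c,
                      forall j : 'I_m, ratr (tnth (computed c') j)
                        = getm st (k + (l + size (transformations op) - m) + j) x &
                      flag c' = phi x]
              else C' x = None
          | None => C' x = None
          end].

(* The operation may depend on the dimensions, on the numbers of measures and
   on the parameters of F, but not on the contents of the input cube. *)
Definition expressible (k l m : nat) (F : cube D k l -> cube D k m) : Prop :=
  exists op : olap_op, forall C : cube D k l, olap_output op C (F C).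

Definition slice_dice (k l : nat) (i : 'I_d) (a : member (D i))
    (C : cube D k l) : cube D k l := fun x =>
  if x i == a then
    omap (fun c => CellData (protected c) (computed c) true) (C x)
  else None.

End Semantics.

(* Main.v *)
Require Import Defs.
From mathcomp Require Import all_boot all_order all_algebra.
From mathcomp Require Import realalg boolp.

(** The cells to keep are those satisfying the Boolean test [Bottom = a]: by
    soundness, an element of the base rolls up to no other element of the
    bottom level than itself. *)

Set Implicit Arguments.
Unset Strict Implicit.
Unset Printing Implicit Defensive.

Import Order.TTheory GRing.Theory.

Local Open Scope ring_scope.

(** The operation has an empty list of transformations: its destructor is the test above and its
    flag the constant 1. Its arity being [l], the last [l] computed measures are those of the input,
    so surviving cells keep their measures. It remains to see that the test holds exactly where $x_i
    = a$, which is [rolls_up_Bottom]. *)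

Lemma ex_hierarchy (S : schema) : exists H : seq S, hierarchy H.
Proof.
have /connectP[p pathp lastp] : connect (@level_edge S) (Bottom S) (All S).
  by rewrite level_edge_connect le0x.
by exists (Bottom S :: p); rewrite /= eqxx pathp -lastp eqxx.
Qed.

Lemma Bottom_hierarchy (S : schema) (H : seq S) : hierarchy H -> Bottom S \in H.
Proof. by case: H => // x p /and3P[/eqP-> _ _]; rewrite mem_head. Qed.

Lemma rollup_refl (D : predimension) (H : seq (sch D)) (l : sch D) (b : elem D) :
  l \in H -> b \in dom l -> rollup H b b.
Proof.
by move=> lH bl; rewrite /rollup connect0 andbT andbb inE; apply/hasP; exists l.
Qed.

(** Along any hierarchy [b] also rolls up to itself by the empty path, so soundness at level
    [Bottom] forces [c] to be [b]. The converse uses the same empty path, in some hierarchy, which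
    exists because $Bottom \le All$. *)
Lemma rolls_up_Bottom (D : dimension) (b c : elem D) : b \in base D ->
  rolls_up (Bottom (sch D)) b c <-> b = c.
Proof.
move=> bB; split=> [[cB [H [hH BH Hbc]]]|<-].
  exact: (graph_sound hH hH BH BH bB bB cB (rollup_refl BH bB) Hbc).
have [H hH] := ex_hierarchy (sch D); have BH := Bottom_hierarchy hH.
by split=> //; exists H; split=> //; apply: rollup_refl bB.
Qed.

Lemma test_rolls_up_Bottom (d : nat) (D : 'I_d -> dimension) (i : 'I_d)
    (a : member (D i)) (x : cell D) :
  test (rolls_up (Bottom (sch (D i))) (Defs.coord x i) (val a)) = (x i == a)%:R.
Proof.
rewrite /test; congr (_%:R); congr nat_of_bool; apply/asboolP/eqP.
  by move/(rolls_up_Bottom _ (valP (x i)))/val_inj.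
by move=> xa; apply/(rolls_up_Bottom _ (valP (x i))); rewrite /Defs.coord xa.
Qed.

Lemma getm_init_computed (d : nat) (D : 'I_d -> dimension) (k l : nat)
    (C : cube D k l) (j : 'I_l) :
  getm (init_state C) (k + j) = input_measure C (inr j).
Proof.
rewrite /getm /init_state nth_cat size_map size_enum_ord.
rewrite ltnNge leq_addr /= addKn (nth_map j) ?size_enum_ord //.
by rewrite nth_ord_enum.
Qed.

Theorem mainTheorem4 (d : nat) (hd : (1 <= d)%N) (D : 'I_d -> dimension)
    (k l : nat) (i : 'I_d) (a : member (D i)) :
  expressible (@slice_dice d D k l i a).
Proof.
pose is_a := Created (@TestLevelEq d D i (Bottom (sch (D i))) (val a)).
exists (OlapOp [::] (Some is_a) (Created (Const D 1))) => C.
split; first by rewrite addn0.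
exists (init_state C), (rcons (init_state C)
  (bool_measure (fun x : cell D => x i == a), source_grouping is_a)).
exists (fun x => x i == a), xpredT; split=> //=.
- exact: RunsNil.
- split=> //; split=> [|x _]; first exact: valP a.
  by rewrite test_rolls_up_Bottom.
- by move=> x _; rewrite rmorph1.
- move=> x; rewrite /slice_dice; case Cx: (C x) => [c|]; last by case: eqP.
  case: eqP => // _; eexists; first by [].
  (* With no transformation, the retained computed measures start at offset $l + 0 - l = 0$ after
     the [k] protected ones. *)
  split=> // j; rewrite addn0 subnn addn0 getm_init_computed.
  by rewrite /input_measure Cx.
Qed.
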